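(* Let $\Omega\subseteq\mathbb{R}^n$ be open, and let $\mathbb{I}=(I,\le,\mathcal{I})$ be a set of indices which, together with $\mathcal{J}\subseteq\mathcal{I}$, a map $\varepsilon\mapsto\underline\varepsilon$ and a map $\varepsilon\mapsto\Omega_\varepsilon$, satisfies assumptions (A1)–(A4) of the context. Let $u\in\mathcal{G}^{\mathbb{I}}(\Omega)$. Then: (i) if $x\in\widetilde{\Omega}_c^{\mathbb{I}}$, then $u(x)$ is a well-defined element of $\widetilde{\mathbb{R}}^{\mathbb{I}}$; (ii) $u=0$ in $\mathcal{G}^{\mathbb{I}}(\Omega)$ if and only if $u(x)=0$ in $\widetilde{\mathbb{R}}^{\mathbb{I}}$ for all $x\in\widetilde{\Omega}_c^{\mathbb{I}}$.
   Context: $\mathbb{N}=\{0,1,2,\dots\}$; $K\Subset\Omega$ means that $K$ is a compact subset of $\Omega$. Set of indices: $\mathbb{I}=(I,\le,\mathcal{I})$ is a set of indices if $(I,\le)$ is a non-empty pre-ordered set (reflexive and transitive relation); $\mathcal{I}$ is a set of subsets of $I$ with $\emptyset\notin\mathcal{I}$ and $I\in\mathcal{I}$; for all $A,B\in\mathcal{I}$ there is $C\in\mathcal{I}$ with $C\subseteq A\cap B$; and, writing $A_{\le e}:=\{\varepsilon\in A\mid\varepsilon\le e\}$ and $\varepsilon<e$ for ''$\varepsilon\le e$ and $\varepsilon\ne e$'', whenever $e\le a\in A\in\mathcal{I}$ the set $A_{\le e}$ is non-empty and for all $b,c\in A_{\le e}$ there is $d\in A_{\le e}$ with $d<b$ and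 $d<c$. Big-O: for $a\in A\in\mathcal{I}$ and nets $(x_\varepsilon),(y_\varepsilon)$ indexed by $I$, $x_\varepsilon=O_{a,A}(y_\varepsilon)$ means $\exists H\in\mathbb{R}_{>0}\,\exists\varepsilon_0\in A_{\le a}\,\forall\varepsilon\in A_{\le\varepsilon_0}:\ |x_\varepsilon|\le H|y_\varepsilon|$. For $\mathcal{J}\subseteq\mathcal{I}$, $x_\varepsilon=O_{\mathcal{J}}(y_\varepsilon)$ means $\exists A\in\mathcal{J}\,\forall a\in A:\ x_\varepsilon=O_{a,A}(y_\varepsilon)$; and $O:=O_{\mathcal{I}}$. A sequence $(z_k)_{k\in\mathbb{N}}$ of $A_{\le a}$ tends to $\emptyset$ in $A_{\le a}$ if $\forall\varepsilon_0\in A_{\le a}\,\exists K\in\mathbb{N}\,\forall k\ge K:\ z_k<\varepsilon_0$. Assumptions: (A1) For each $a\in A\in\mathcal{I}$ there exists a sequence of $A_{\le a}$ which tends to $\emptyset$ in $A_{\le a}$; moreover, for all $b,c\in A_{\le a}$, $b<c$ or $c\le b$. (A2) $\mathcal{J}\subseteq\mathcal{I}$ is non-empty and for all $A,B\in\mathcal{J}$ there is $C\in\mathcal{J}$ with $C\subseteq A\cap B$. (A3) There is a map $I\to(0,1]$, $\varepsilon\mapsto\underline\varepsilon$, such that $\exists A\in\mathcal{I}\,\forall a\in A:\ \lim_{\varepsilon\in A_{\le a}}\underline\varepsilon=0$ (limit along the downward directed set $A_{\le a}$). (A4) A map $\varepsilon\mapsto\Omega_\varepsilon$ is given, where $\Omega_\varepsilon$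 is an open subset of $\mathbb{R}^n$ for each $\varepsilon\in I$. Generalized functions: $\mathcal{E}^{\mathbb{I}}(\Omega)$ is the set of families $u=(u_\varepsilon)_{\varepsilon\in I}$ with $u_\varepsilon\in\mathcal{C}^\infty(\Omega_\varepsilon,\mathbb{R})$ for all $\varepsilon\in I$. $u\in\mathcal{E}_M^{\mathbb{I}}(\Omega)$ iff $u\in\mathcal{E}^{\mathbb{I}}(\Omega)$ and $\forall K\Subset\Omega\,\forall\alpha\in\mathbb{N}^n\,\exists N\in\mathbb{N}:\ \sup_{x\in K}|\partial^\alpha u_\varepsilon(x)|=O_{\mathcal{J}}(\underline\varepsilon^{-N})$. If $u\in\mathcal{E}_M^{\mathbb{I}}(\Omega)$, then $u\in\mathcal{N}^{\mathbb{I}}(\Omega)$ iff $\forall K\Subset\Omega\,\forall m\in\mathbb{N}:\ \sup_{x\in K}|u_\varepsilon(x)|=O(\underline\varepsilon^{m})$. $\mathcal{G}^{\mathbb{I}}(\Omega):=\mathcal{E}_M^{\mathbb{I}}(\Omega)/\mathcal{N}^{\mathbb{I}}(\Omega)$. Generalized points: $\Omega_M^{\mathbb{I}}:=\{(x_\varepsilon)\in\Omega^I\mid\exists N\in\mathbb{N}:\ x_\varepsilon=O_{\mathcal{J}}(\underline\varepsilon^{-N})\}$; for $(x_\varepsilon),(y_\varepsilon)\in\Omega_M^{\mathbb{I}}$, $(x_\varepsilon)\sim_{\mathbb{I}}(y_\varepsilon)$ iff $\forall m\in\mathbb{N}:\ x_\varepsilon-y_\varepsilon=O(\underline\varepsilon^{m})$;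 $\widetilde\Omega^{\mathbb{I}}:=\Omega_M^{\mathbb{I}}/\sim_{\mathbb{I}}$. $\widetilde{\mathbb{R}}^{\mathbb{I}}$ is the same construction with $\mathbb{R}$ in place of $\Omega$. For a property $\mathcal{P}(\varepsilon)$, $\forall^{\mathbb{I}}\varepsilon:\mathcal{P}(\varepsilon)$ (''for $\varepsilon\in\mathbb{I}$ sufficiently small $\mathcal{P}(\varepsilon)$ holds'') means $\exists A\in\mathcal{I}\,\forall a\in A\,\exists\varepsilon_0\le a\,\forall\varepsilon\in A_{\le\varepsilon_0}:\ \mathcal{P}(\varepsilon)$. $[x_\varepsilon]\in\widetilde\Omega_c^{\mathbb{I}}$ iff $[x_\varepsilon]\in\widetilde\Omega^{\mathbb{I}}$ and $\exists K\Subset\Omega\,\forall^{\mathbb{I}}\varepsilon:\ x_\varepsilon\in K$. For $u=[u_\varepsilon]\in\mathcal{G}^{\mathbb{I}}(\Omega)$ and $x=[x_\varepsilon]\in\widetilde\Omega_c^{\mathbb{I}}$, $u(x):=[u_\varepsilon(x_\varepsilon)]$.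
   Formalization: Moderateness of u includes that each compact K of Ω lies in Ω_ε for J-small ε, so the suprema are defined; u(x) is the class of any O_J-moderate net equal to u_ε(x_ε) for I-small ε, since for J≠I the net u_ε(x_ε) itself may fail to be moderate. *)

(* Defs.v *)
From HB Require Import structures.
From mathcomp Require Import all_boot all_order all_algebra.
From mathcomp Require Import all_classical all_reals all_analysis.
Set Implicit Arguments.
Unset Strict Implicit.
Unset Printing Implicit Defensive.
Import Order.TTheory GRing.Theory Num.Theory.
Import numFieldNormedType.Exports.
Local Open Scope classical_set_scope.
Local Open Scope ring_scope.

(* R^n is 'rV[R]_n with its sup norm, which is equivalent to the Euclidean one;
   the O-estimates below are insensitive to the difference. *)

Section IndexSets.
Context {d : Order.disp_t} {I : preorderType d}.
Implicit Types (A B C : set I) (cF cI cJ : set (set I)) (a b c e : I).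

(* Not Order.lt: on a preorder, the library's e < f means e <= f and
   ~ (f <= e), whereas here it means e <= f and e <> f. *)
Definition slt e f : Prop := (e <= f)%O /\ e <> f.

Definition below A e : set I := [set f | A f /\ (f <= e)%O].

Definition index_set cI : Prop :=
  [/\ [set: I] !=set0,
      ~ cI set0,
      cI setT,
      forall A B, cI A -> cI B -> exists2 C, cI C & C `<=` A `&` B
    & forall A a e, cI A -> A a -> (e <= a)%O ->
        below A e !=set0 /\
        forall b c, below A e b -> below A e c ->
          exists f, [/\ below A e f, slt f b & slt f c]].

Definition tends_to_empty A a (z : nat -> I) : Prop :=
  forall e0, below A a e0 -> exists k0, forall k, (k0 <= k)%N -> slt (z k) e0.

Definition assumption1 cI : Prop :=
  forall A a, cI A -> A a ->
    (exists z : nat -> I,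
        (forall k, below A a (z k)) /\ tends_to_empty A a z) /\
    (forall b c, below A a b -> below A a c -> slt b c \/ (c <= b)%O).

Definition assumption2 cI cJ : Prop :=
  [/\ cJ `<=` cI,
      cJ !=set0
    & forall A B, cJ A -> cJ B -> exists2 C, cJ C & C `<=` A `&` B].

(* The filter of tails of the downward directed set A_{<= a}. *)
Definition tails A a : set_system I := filter_from (below A a) (below A).

Definition assumption3 {R : realType} cI (eps : I -> R) : Prop :=
  (forall e, 0 < eps e <= 1) /\
  exists2 A, cI A & forall a, A a -> eps e @[e --> tails A a] --> (0 : R).

Definition for_small cF (P : I -> Prop) : Prop :=
  exists2 A, cF A & forall a, A a ->
    exists2 e0, (e0 <= a)%O & forall e, below A e0 e -> P e.

Definition bigO_at {R : realType} {V : normedZmodType R} a A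
    (x : I -> V) (y : I -> R) : Prop :=
  exists2 H : R, 0 < H & exists2 e0, below A a e0 &
    forall e, below A e0 e -> `|x e| <= H * `|y e|.

Definition bigO {R : realType} {V : normedZmodType R} cF
    (x : I -> V) (y : I -> R) : Prop :=
  exists2 A, cF A & forall a, A a -> bigO_at a A x y.

End IndexSets.

Section Smooth.
Context {R : realType} {n : nat}.
Implicit Types (f : 'rV[R]_n -> R) (s : seq 'I_n) (alpha : 'I_n -> nat).

Definition partial (i : 'I_n) f : 'rV[R]_n -> R :=
  fun x => 'D_(delta_mx 0 i) f x.

Definition iter_partial s f : 'rV[R]_n -> R := foldr partial f s.

Definition mpartial alpha f : 'rV[R]_n -> R :=
  iter_partial (flatten [seq nseq (alpha i) i | i <- enum 'I_n]) f.

(* f is C^oo on W: all mixed partial derivatives of all orders exist and are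
   continuous on W.  Used for open W only, so that values of f outside W are
   irrelevant: f encodes a function defined on W. *)
Definition smooth_on (W : set 'rV[R]_n) f : Prop :=
  forall s x, W x ->
    {for x, continuous (iter_partial s f)} /\
    forall i, derivable (iter_partial s f) x (delta_mx 0 i).

End Smooth.

Definition eqv_class {T : Type} (X : set T) (E : T -> T -> Prop) (x : T) :
  set T := [set y | X y /\ E x y].

Definition quotient_set {T : Type} (X : set T) (E : T -> T -> Prop) :
  set (set T) := eqv_class X E @` X.

Definition compact_in {T : topologicalType} (K W : set T) : Prop :=
  compact K /\ K `<=` W.

Section Points.
Context {R : realType} {d : Order.disp_t} {I : preorderType d}.
Context (cI cJ : set (set I)) (eps : I -> R).
Context {V : normedZmodType R}.

Definition moderate_net (X : set V) : set (I -> V) :=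
  [set x | (forall e, X (x e)) /\
           exists N : nat, bigO cJ x (fun e => eps e ^- N)].

Definition net_eqv (x y : I -> V) : Prop :=
  forall m : nat, bigO cI (fun e => x e - y e) (fun e => eps e ^+ m).

Definition net_class (X : set V) : (I -> V) -> set (I -> V) :=
  eqv_class (moderate_net X) net_eqv.

Definition gen_points (X : set V) : set (set (I -> V)) :=
  quotient_set (moderate_net X) net_eqv.

End Points.

Section Functions.
Context {R : realType} {n : nat} {d : Order.disp_t} {I : preorderType d}.
Context (cI cJ : set (set I)) (eps : I -> R).
Context (Om : set 'rV[R]_n) (Ome : I -> set 'rV[R]_n).

Implicit Types (u v : I -> 'rV[R]_n -> R) (x : I -> 'rV[R]_n).

(* u e is a total function, but only its restriction to Ome e is meaningful. *)
Definition smooth_family : set (I -> 'rV[R]_n -> R) :=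
  [set u | forall e, smooth_on (Ome e) (u e)].

Definition sup_partial (K : set 'rV[R]_n) (alpha : 'I_n -> nat) u : I -> R :=
  fun e => sup [set `|mpartial alpha (u e) p| | p in K].

(* No relation between Om and the sets Ome e is assumed.  As u e lives on
   Ome e, the O-condition on the supremum over K is meaningful only if
   K `<=` Ome e for the small e it refers to; this is made explicit.  It also
   makes the real-valued sup a genuine supremum (or 0 if K is empty). *)
Definition moderate_family : set (I -> 'rV[R]_n -> R) :=
  [set u | smooth_family u /\
     forall K, compact_in K Om ->
       for_small cJ (fun e => K `<=` Ome e) /\
       forall alpha, exists N : nat,
         bigO cJ (sup_partial K alpha u) (fun e => eps e ^- N)].

Definition null_family : set (I -> 'rV[R]_n -> R) :=
  [set u | moderate_family u /\
     forall K, compact_in K Om -> forall m : nat,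
       bigO cI (fun e => sup [set `|u e p| | p in K]) (fun e => eps e ^+ m)].

Definition family_eqv u v : Prop := null_family (fun e => u e \- v e).

Definition gen_fun_class :
  (I -> 'rV[R]_n -> R) -> set (I -> 'rV[R]_n -> R) :=
  eqv_class moderate_family family_eqv.

Definition gen_functions : set (set (I -> 'rV[R]_n -> R)) :=
  quotient_set moderate_family family_eqv.

Definition gen_fun0 : set (I -> 'rV[R]_n -> R) := gen_fun_class (fun _ _ => 0).

Definition gen_reals : set (set (I -> R)) := gen_points cI cJ eps [set: R].

Definition gen_real0 : set (I -> R) := net_class cI cJ eps [set: R] (fun _ => 0).

Definition compact_points : set (set (I -> 'rV[R]_n)) :=
  [set xi | gen_points cI cJ eps Om xi /\
     exists2 x, xi x &
       exists2 K, compact_in K Om & for_small cI (fun e => K (x e))].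

(* The class [u_e(x_e)].  For x in a compactly supported class, x e is in the
   domain Ome e of u e only for small e, so the net (u_e(x_e)) is only defined
   for small e: its class is that of any moderate net z agreeing with it for
   small e.  If (u_e(x_e)) is itself defined for small e and moderate, this is
   its ordinary class; if no such z exists, it is empty, hence not an element
   of gen_reals. *)
Definition value_at u x : set (I -> R) :=
  [set w | exists z, [/\ moderate_net cJ eps [set: R] z,
       for_small cI (fun e => Ome e (x e) /\ z e = u e (x e))
     & net_class cI cJ eps [set: R] z w]].

(* The choice-free lift of value_at to classes: the common value of
   value_at u x over all representatives when it does not depend on them. *)
Definition gen_value (U : set (I -> 'rV[R]_n -> R))
    (xi : set (I -> 'rV[R]_n)) : set (I -> R) :=
  \bigcup_(u in U) \bigcup_(x in xi) value_at u x.

Definition gen_value_well_defined (U : set (I -> 'rV[R]_n -> R))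
    (xi : set (I -> 'rV[R]_n)) : Prop :=
  gen_reals (gen_value U xi) /\
  forall u x, U u -> xi x -> value_at u x = gen_value U xi.

End Functions.

(* Main.v *)
Require Import Defs.
From HB Require Import structures.
From mathcomp Require Import all_boot all_order all_algebra.
From mathcomp Require Import all_classical all_reals all_analysis.
Set Implicit Arguments.
Unset Strict Implicit.
Unset Printing Implicit Defensive.
Import Order.TTheory GRing.Theory Num.Theory.
Import numFieldNormedType.Exports.
(* From here on [bigO] is the relation between nets, not the one of Landau for
   functions along a filter. *)
Import Defs.
Local Open Scope classical_set_scope.
Local Open Scope ring_scope.

(** A generalized function [u] is evaluated at a compactly supported point
    [x], with [x e] in a compact set [K] for small [e], by taking the values
    [u e (x e)].  Two facts make this well defined.

    If [y] is equivalent to [x], then [x e - y e] is O(eps) and eps tends to 0,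
    so the whole ball around [x e] that reaches [y e] lies in a slightly larger
    compact subset [L] of [Om] ([net_eqv_thickening]).  On [L] the gradient of
    [u e] grows at most like a negative power of eps, while the distance from
    [x e] to [y e] is smaller than every positive power; by the mean value
    inequality the two values differ by a negligible amount ([value_eqv]).

    If [v] is equivalent to [u], then the supremum of [u e - v e] over [K] is
    negligible, and so are its values at points of [K] ([null_value]).

    Conversely, suppose that all values of [u] vanish and let [K] be a compact
    subset of [Om].  Choose [x e] in [K] such that [u e (x e)] reaches at least
    half of the supremum of [u e] over [K].  The net [x] stays in [K], so it
    represents a compactly supported point, and the negligibility of the value
    of [u] there is that of the suprema over [K] ([null_of_values]).

    All O-estimates are combined by one principle ([on_tails2]): after passing
    to a common refinement of the index sets, an estimate at a fixed index [a]
    says that some inequality holds along a single filter, and filters are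
    closed under intersection.  The constants may vary with [a]. *)

(** * Index sets as families of filters *)

Section Tails.
Context {d : Order.disp_t} {I : preorderType d}.
Implicit Types (A B C : set I) (cF cI cJ : set (set I)) (a b c e : I).
Implicit Types (F G : set_system I) (Phi Psi : set_system I -> Prop).

(** Estimates have to be combined along [cI] and along [cJ]; this is the part of
    the axioms that holds for both and makes that possible. *)
Definition tail_base cF : Prop :=
  (forall A B, cF A -> cF B -> exists2 C, cF C & C `<=` A `&` B) /\
  forall A a e, cF A -> A a -> (e <= a)%O ->
    below A e !=set0 /\
    forall b c, below A e b -> below A e c ->
      exists f, [/\ below A e f, (f <= b)%O & (f <= c)%O].

Lemma index_set_tail_base cI : index_set cI -> tail_base cI.
Proof.
move=> [_ _ _ hcap hdir]; split=> // A a e cA Aa ea.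
have [? hd] := hdir A a e cA Aa ea; split=> // b c hb hc.
by have [f [? [? _] [? _]]] := hd b c hb hc; exists f.
Qed.

Lemma sub_tail_base cI cJ :
  index_set cI -> assumption2 cI cJ -> tail_base cJ.
Proof.
move=> /index_set_tail_base[_ hdir] [JI _ hcap]; split=> // A a e cA.
exact: hdir (JI _ cA).
Qed.

(** The common shape of [bigO] and [for_small].  Quantifying over properties of
    the filter, not of single indices, lets constants depend on [a]. *)
Definition on_tails cF Phi : Prop :=
  exists2 A, cF A & forall a, A a -> Phi (tails A a).

Definition monotone Phi : Prop := forall F G, F `<=` G -> Phi F -> Phi G.

Lemma tails_filter cF A a : tail_base cF -> cF A -> A a -> Filter (tails A a).
Proof.
move=> [_ hdir] cA Aa; have [ne dir] := hdir A a a cA Aa (lexx a).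
apply: filter_from_filter => // b c hb hc.
have [f [hf fb fc]] := dir b c hb hc.
by exists f => // e [Ae ef]; split; split=> //; exact: le_trans ef _.
Qed.

(** Shrinking [A] only enlarges the filters: below any index of [A] there is one
    of the smaller set [C]. *)
Lemma sub_tails cF A C a :
  tail_base cF -> cF C -> C `<=` A -> C a -> tails A a `<=` tails C a.
Proof.
move=> [_ hdir] cC CA Ca Q [b [Ab ba] bQ].
have [[f [Cf fb]] _] := hdir C a b cC Ca ba.
exists f; first by split=> //; exact: le_trans fb ba.
move=> e [Ce ef]; apply: bQ; split; first exact: CA.
exact: le_trans ef fb.
Qed.

(** On a common refinement [C] of the two index sets both hypotheses concern the
    same filter [tails C a]. *)
Lemma on_tails2 cF Phi Psi Theta :
    tail_base cF -> monotone Phi -> monotone Psi ->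
    (forall F, Filter F -> Phi F -> Psi F -> Theta F) ->
  on_tails cF Phi -> on_tails cF Psi -> on_tails cF Theta.
Proof.
move=> base mPhi mPsi imp [A cA hA] [B cB hB].
have [C cC CAB] := base.1 A B cA cB; exists C => // a Ca.
have [Aa Ba] := CAB a Ca; have FC := tails_filter base cC Ca; apply: imp.
  by apply: mPhi (hA a Aa); apply: (sub_tails base) Ca => // x /CAB[].
by apply: mPsi (hB a Ba); apply: (sub_tails base) Ca => // x /CAB[].
Qed.

Lemma for_smallE cF (P : I -> Prop) :
  tail_base cF -> for_small cF P <-> on_tails cF (fun F => F [set e | P e]).
Proof.
move=> [_ hdir]; split=> -[A cA hA]; exists A => // a Aa; have := hA a Aa.
  move=> [b ba bP]; have [[f [Af fb]] _] := hdir A a b cA Aa ba.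
  exists f; first by split=> //; exact: le_trans fb ba.
  by move=> e [Ae ef]; apply: bP; split=> //; exact: le_trans ef fb.
by move=> [b [_ ba] bP]; exists b.
Qed.

Lemma mem_monotone (P : set I) : monotone (fun F => F P).
Proof. by move=> F G; exact. Qed.

Lemma for_small2 cF (P Q S : I -> Prop) :
    tail_base cF -> (forall e, P e -> Q e -> S e) ->
  for_small cF P -> for_small cF Q -> for_small cF S.
Proof.
move=> base imp /(for_smallE _ base) hP /(for_smallE _ base) hQ.
apply/for_smallE => //; move: hP hQ; apply: on_tails2 => //; [exact: mem_monotone..|] => F FF.
by apply: filterS2 => e; exact: imp.
Qed.

Lemma for_smallW cF (P Q : I -> Prop) :
  (forall e, P e -> Q e) -> for_small cF P -> for_small cF Q.
Proof.
move=> imp [A cA hA]; exists A => // a /hA[b ba bP].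
by exists b => // e /bP/imp.
Qed.

Lemma sub_for_small cI cJ (P : I -> Prop) :
  cJ `<=` cI -> for_small cJ P -> for_small cI P.
Proof. by move=> JI [A /JI cA hA]; exists A. Qed.

Lemma for_smallT cF (P : I -> Prop) :
  cF !=set0 -> (forall e, P e) -> for_small cF P.
Proof. by move=> [A cA] hP; exists A => // a _; exists a. Qed.

End Tails.

(** * Calculus of O-estimates *)

Section BigO.
Context {R : realType} {d : Order.disp_t} {I : preorderType d}.
Context (cF : set (set I)) (base : tail_base cF).
Implicit Types (F G : set_system I) (x y z : I -> R).

Definition dominated {V : normedZmodType R} (x : I -> V) (y : I -> R) F : Prop :=
  exists2 H : R, 0 < H & F [set e | `|x e| <= H * `|y e|].

Lemma dominated_monotone {V : normedZmodType R} (x : I -> V) (y : I -> R) :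
  monotone (dominated x y).
Proof. by move=> F G FG [H H0 FH]; exists H => //; exact: FG. Qed.

Lemma bigOE {V : normedZmodType R} (x : I -> V) (y : I -> R) :
  bigO cF x y <-> on_tails cF (dominated x y).
Proof. by []. Qed.

Lemma bigO_le {V W : normedZmodType R} (c : R) (x : I -> V) (y : I -> W)
    (z : I -> R) :
    0 <= c -> for_small cF (fun e => `|x e| <= c * `|y e|) ->
  bigO cF y z -> bigO cF x z.
Proof.
move=> c0 /(for_smallE _ base) hxy /bigOE hyz; apply/bigOE; move: hxy hyz.
apply: on_tails2 => //; [exact: mem_monotone|exact: dominated_monotone|].
move=> F FF Fxy [H H0 Fyz]; exists ((c + 1) * H); first by rewrite mulr_gt0 ?ltr_wpDl.
move: Fxy Fyz; apply: filterS2 => e /= xy yz.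
apply: le_trans xy _; rewrite -mulrA.
apply: (@le_trans _ _ (c * (H * `|z e|))); first exact: ler_wpM2l.
by rewrite ler_wpM2r ?lerDl// mulr_ge0// ltW.
Qed.

Lemma bigO_ext {V : normedZmodType R} (x y : I -> V) (z : I -> R) :
  for_small cF (fun e => x e = y e) -> bigO cF y z -> bigO cF x z.
Proof.
move=> xy; apply: (@bigO_le _ _ 1) => //; apply: for_smallW xy => e ->.
by rewrite mul1r.
Qed.

Lemma bigOD {V : normedZmodType R} (x y : I -> V) (z : I -> R) :
  bigO cF x z -> bigO cF y z -> bigO cF (fun e => x e + y e) z.
Proof.
move=> /bigOE hx /bigOE hy; apply/bigOE; move: hx hy.
apply: on_tails2 => //; [exact: dominated_monotone..|].
move=> F FF [H H0 Fx] [K K0 Fy]; exists (H + K); first exact: addr_gt0.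
move: Fx Fy; apply: filterS2 => e /= hx hy.
by rewrite mulrDl (le_trans (ler_normD _ _))// lerD.
Qed.

Lemma bigOM x y x' y' :
  bigO cF x x' -> bigO cF y y' ->
  bigO cF (fun e => x e * y e) (fun e => x' e * y' e).
Proof.
move=> /bigOE hx /bigOE hy; apply/bigOE; move: hx hy.
apply: on_tails2 => //; [exact: dominated_monotone..|].
move=> F FF [H H0 Fx] [K K0 Fy]; exists (H * K); first exact: mulr_gt0.
move: Fx Fy; apply: filterS2 => e /= hx hy.
by rewrite !normrM mulrACA ler_pM.
Qed.

Lemma bigO_ler {V : normedZmodType R} (x : I -> V) y z :
  (forall e, `|y e| <= `|z e|) -> bigO cF x y -> bigO cF x z.
Proof.
move=> yz [A cA hA]; exists A => // a /hA[H H0 [b Ab hb]].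
exists H => //; exists b => // e /hb /le_trans; apply.
by rewrite ler_pM2l.
Qed.

Lemma bigO0 {V : normedZmodType R} z :
  cF !=set0 -> bigO cF (fun _ => 0 : V) z.
Proof.
move=> [A cA]; exists A => // a Aa; exists 1 => //; exists a; first by split.
by move=> e _; rewrite normr0 mul1r.
Qed.

Section Powers.
Context (eps : I -> R) (eps01 : forall e, 0 < eps e <= 1).

Lemma bigO_expN_le {V : normedZmodType R} (x : I -> V) (N M : nat) :
  (N <= M)%N -> bigO cF x (fun e => eps e ^- N) ->
  bigO cF x (fun e => eps e ^- M).
Proof.
move=> NM; apply: bigO_ler => e; have /andP[e0 e1] := eps01 e.
rewrite !gtr0_norm ?invr_gt0 ?exprn_gt0//.
by rewrite lef_pV2 ?posrE ?exprn_gt0// ler_wiXn2l// ltW.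
Qed.

Lemma bigO_bounded {V : normedZmodType R} (x : I -> V) (M : R) :
  cF !=set0 -> (forall e, `|x e| <= M) -> bigO cF x (fun e => eps e ^- 0).
Proof.
move=> [A cA] xM; exists A => // a Aa; exists (`|M| + 1).
  by rewrite ltr_wpDl.
exists a; first by split.
move=> e _; rewrite expr0 invr1 normr1 mulr1 (le_trans (xM e))//.
by rewrite (le_trans (ler_norm M))// lerDl.
Qed.

Lemma bigO_expN_sum (J : Type) (s : seq J) (x : J -> I -> R) :
    cF !=set0 ->
    (forall j, exists N : nat, bigO cF (x j) (fun e => eps e ^- N)) ->
  exists N : nat, bigO cF (fun e => \sum_(j <- s) x j e) (fun e => eps e ^- N).
Proof.
move=> ne hx; elim: s => [|j s [N hN]].
  by exists 0%N; under eq_fun do rewrite big_nil; exact: bigO0.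
have [M hM] := hx j; exists (maxn M N); under eq_fun do rewrite big_cons.
apply: bigOD => //.
- exact: bigO_expN_le (leq_maxl _ _) hM.
- exact: bigO_expN_le (leq_maxr _ _) hN.
Qed.

End Powers.
End BigO.

Lemma sub_bigO {R : realType} {d : Order.disp_t} {I : preorderType d}
    (cI cJ : set (set I)) {V : normedZmodType R} (x : I -> V) (y : I -> R) :
  cJ `<=` cI -> bigO cJ x y -> bigO cI x y.
Proof. by move=> JI [A /JI cA hA]; exists A. Qed.

(** A net that is O(eps) becomes smaller than every [r > 0], although the
    O-constant may vary with [a]: for each [a] separately, [eps e] is eventually
    below [r / H]. *)
Lemma bigO_eps_small {R : realType} {d : Order.disp_t} {I : preorderType d}
    (cI : set (set I)) (eps : I -> R) {V : normedZmodType R} (x : I -> V)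
    (r : R) :
    tail_base cI -> assumption3 cI eps -> 0 < r ->
  bigO cI x (fun e => eps e ^+ 1) -> for_small cI (fun e => `|x e| < r).
Proof.
move=> base [eps01 lim0] r0 /bigOE hx; apply/for_smallE => //.
have {}lim0 : on_tails cI (fun F => eps @ F --> (0 : R)).
  by case: lim0 => A cA hA; exists A.
move: lim0 hx; apply: on_tails2 => //.
- by move=> F G FG h P /h /FG.
- exact: dominated_monotone.
move=> F FF eps0 [H H0 Fx].
have : F (eps @^-1` ball (0 : R) (r / H)).
  by apply: (eps0 (ball (0 : R) (r / H))); apply: nbhsx_ballx; rewrite divr_gt0.
move: Fx; apply: filterS2 => e /= hx; rewrite /ball/= sub0r normrN ltr_pdivlMr// => he.
by rewrite (le_lt_trans hx)// expr1 mulrC.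
Qed.

(** * Suprema over compact sets *)

Section Suprema.
Context {R : realType} {T : topologicalType}.
Implicit Types (K : set T) (f : T -> R).

Lemma sup_norm_ge0 K f : 0 <= sup [set `|f p| | p in K].
Proof.
have [hs|/sup_out->//] := pselect (has_sup [set `|f p| | p in K]).
have [[_ [p Kp _]] ub] := hs.
by apply: (@le_trans _ _ `|f p|) => //; apply: ub_le_sup => //; exists p.
Qed.

Lemma sup_norm_le K f (M : R) :
  0 <= M -> (forall p, K p -> `|f p| <= M) -> sup [set `|f p| | p in K] <= M.
Proof.
move=> M0 fM; have [->|/set0P[p Kp]] := eqVneq K set0.
  by rewrite image_set0 sup0.
apply: ge_sup; first by exists `|f p|; exists p.
by move=> _ [q Kq <-]; exact: fM.
Qed.

Lemma le_sup_norm K f p :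
    compact K -> (forall q, K q -> {for q, continuous f}) -> K p ->
  `|f p| <= sup [set `|f q| | q in K].
Proof.
move=> cK cf Kp; apply: ub_le_sup; last by exists p.
have cont : {within K, continuous (fun q => `|f q|)}.
  apply: continuous_in_subspaceT => q /set_mem Kq.
  by apply: continuous_comp; [exact: cf|exact: norm_continuous].
have [M [_ hM]] := compact_bounded (continuous_compact cont cK).
exists (M + 1) => _ [q Kq <-].
have lt : M < M + 1 by rewrite ltrDl.
by have := hM _ lt `|f q|; rewrite /= normr_id; apply; exists q.
Qed.

(** Half of a positive supremum is exceeded somewhere, and the supremum of an
    unbounded set is 0 by convention. *)
Lemma sup_norm_le2 K f :
  K !=set0 -> exists2 p, K p & sup [set `|f q| | q in K] <= 2 * `|f p|.
Proof.
move=> [p0 Kp0]; set S := sup _.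
have [S0|S0] := leP S 0; first by exists p0 => //; rewrite (le_trans S0)// mulr_ge0.
have hs : has_sup [set `|f q| | q in K].
  by apply: contrapT => /sup_out S0'; rewrite /S S0' ltxx in S0.
have [_ [p Kp <-]] := sup_adherent (divr_gt0 S0 (ltr0Sn R 1)) hs.
rewrite -/S => hp; exists p => //.
by rewrite mulrC -ler_pdivrMr// ltW// (le_lt_trans _ hp)// {2}(splitr S) addrK.
Qed.

End Suprema.

(** * The maximum norm on row vectors *)

Section RowVectors.
Context {R : realType} {n : nat}.
Implicit Types (p q x y : 'rV[R]_n) (K L W : set 'rV[R]_n).

Lemma ler_coord_norm x (i : 'I_n) : `|x 0 i| <= `|x|.
Proof.
by rewrite [leRHS]/Num.norm/= mx_normrE; apply/bigmax_geP; right; exists (0, i).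
Qed.

Lemma ler_norm_coord x (r : R) :
  0 <= r -> (forall i, `|x 0 i| <= r) -> `|x| <= r.
Proof.
move=> r0 xr; rewrite [leLHS]/Num.norm/= mx_normrE; apply/bigmax_leP; split=> //.
by case=> i j _; rewrite (ord1 i).
Qed.

Lemma box_compact (r : R) : compact [set q : 'rV[R]_n | `|q| <= r].
Proof.
apply: bounded_closed_compact.
  exists r; split; first exact: num_real.
  by move=> M rM q /= qr; rewrite (le_trans qr)// ltW.
have -> : [set q : 'rV[R]_n | `|q| <= r] = Num.norm @^-1` [set t | t <= r] by [].
apply: closed_comp; last exact: closed_le.
by move=> q _; exact: norm_continuous.
Qed.

(** Compactness of [K] makes the distance from [K] to the complement of [W]
    positive; the thickened set is the sum of [K] and a small closed ball. *)
Lemma compact_thickening K W :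
    open W -> compact_in K W ->
  exists r : R, exists2 L, 0 < r & compact_in L W /\
    forall p q, K p -> `|q - p| <= r -> L q.
Proof.
move=> oW [cK KW].
have [r [r0 hr]] : exists r : R, 0 < r /\
    K `<=` [set p | forall q, `|q| <= r -> W (p + q)].
  have /compact_near_coveringP cov := cK.
  have near0 : \forall r \near 0^'+,
      K `<=` [set p | forall q : 'rV[R]_n, `|q| <= r -> W (p + q)].
    apply: cov => p /KW Wp; have [e /= e0 eW] := (nbhs_ballP _ _).1 (oW p Wp).
    exists (ball p (e / 2), [set r : R | r < e / 2]).
      split=> /=; first by apply: nbhsx_ballx; rewrite divr_gt0.
      by apply: nbhs_right_lt; rewrite divr_gt0.
    move=> [p' r] [/= pp' re] q qr; apply: eW; rewrite -ball_normE/= in pp' *.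
    rewrite opprD addrA (le_lt_trans (ler_normB _ _))// [ltRHS]splitr ltrD//.
    exact: le_lt_trans re.
  near (0 : R)^'+ => r; exists r; split; first by near: r; exact: nbhs_right_gt.
  by near: r.
exists r, [set p.1 + p.2 | p in K `*` [set q | `|q| <= r]] => //; split; first split.
- apply: continuous_compact; last by apply: compact_setX => //; exact: box_compact.
  by apply: continuous_subspaceT => -[p q]; exact: add_continuous.
- by move=> _ [[p q] [/= /hr]] h qr <-; exact: h.
- by move=> p q Kp qr; exists (p, q - p) => //=; rewrite subrKC.
Unshelve. all: by end_near. Qed.

(** * The mean value inequality along coordinate paths *)

Lemma coordinate_mean_value (f : 'rV[R]_n -> R) p (i : 'I_n) (h M : R) :
    (forall t : R, `|t| <= `|h| ->
       derivable f (p + t *: delta_mx 0 i) (delta_mx 0 i) /\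
       `|partial i f (p + t *: delta_mx 0 i)| <= M) ->
  `|f (p + h *: delta_mx 0 i) - f p| <= M * `|h|.
Proof.
move=> hf; pose v : 'rV[R]_n := delta_mx 0 i; pose g t := f (p + t *: v).
(* Along the line, [g] and [f] have the same difference quotients. *)
have quot (t : R) : (fun s : R => s^-1 *: ((g \o shift t) (s *: (1 : R)) - g t)) =
    (fun s => s^-1 *: ((f \o shift (p + t *: v)) (s *: v) - f (p + t *: v))).
  apply/funext => s /=; rewrite /g /shift/= [s *: 1]mulr1 scalerDl.
  by rewrite addrCA.
have dg (t : R) : `|t| <= `|h| -> is_derive t (1 : R) g (partial i f (p + t *: v)).
  by move=> /hf[df _]; split; rewrite /derivable /derive ?quot.
have seg a b : a <= b -> (forall t, a <= t <= b -> `|t| <= `|h|) ->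
    `|g b - g a| <= M * (b - a).
  move=> ab abh.
  have [||c] := @MVT_segment R g (fun t => partial i f (p + t *: v)) a b ab.
  - by move=> t; rewrite in_itv/= => /andP[at_ tb]; apply: dg; rewrite abh// !ltW.
  - apply: derivable_within_continuous => t; rewrite in_itv/= => abt.
    by have [] := dg t (abh t abt).
  rewrite in_itv/= => /abh/hf[_ cM] ->.
  by rewrite normrM (ger0_norm (_ : 0 <= b - a)) ?subr_ge0// ler_wpM2r ?subr_ge0.
have g0 : g 0 = f p by rewrite /g scale0r addr0.
rewrite -/v -/(g h) -g0; have [h0|h0] := leP 0 h.
  rewrite (le_trans (seg 0 h h0 _)) ?subr0// ?ger0_norm//.
  by move=> t /andP[t0 th]; rewrite !ger0_norm.
rewrite distrC (le_trans (seg h 0 (ltW h0) _)) ?sub0r ?ltr0_norm//.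
by move=> t /andP[ht t0]; rewrite ler0_norm// lerN2.
Qed.

(** Replacing the coordinates of [x] by those of [y] one at a time never leaves
    the ball around [x], which is a box for the maximum norm; each step is
    controlled by one partial derivative. *)
Lemma mean_value_inequality (f : 'rV[R]_n -> R) x y (M : R) :
    (forall q, `|q - x| <= `|y - x| -> forall i,
       derivable f q (delta_mx 0 i) /\ `|partial i f q| <= M) ->
  `|f y - f x| <= n%:R * M * `|y - x|.
Proof.
move=> hf; pose z k : 'rV[R]_n := \row_j (if (j < k)%N then y 0 j else x 0 j).
have z0 : z 0%N = x by apply/rowP => j; rewrite mxE.
have zn : z n = y by apply/rowP => j; rewrite mxE ltn_ord.
suff: forall k, (k <= n)%N -> `|f (z k) - f x| <= k%:R * (M * `|y - x|).
  by move=> /(_ n (leqnn n)); rewrite zn mulrA.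
elim=> [_|k IH kn]; first by rewrite z0 subrr normr0 mul0r.
pose i := Ordinal kn; pose h := y 0 i - x 0 i.
have hxy : `|h| <= `|y - x|.
  by have := ler_coord_norm (y - x) i; rewrite !mxE.
have zS : z k.+1 = z k + h *: delta_mx 0 i.
  apply/rowP => j; rewrite !mxE eqxx/= ltnS leq_eqVlt -val_eqE/=.
  have [jk|_] := eqVneq (j : nat) k; last by rewrite mulr0 addr0.
  by rewrite jk ltnn mulr1 /h addrC (_ : j = i) ?subrK//; apply/val_inj.
have step : `|f (z k.+1) - f (z k)| <= M * `|h|.
  rewrite zS; apply: coordinate_mean_value => t th; apply: hf.
  apply: ler_norm_coord => [//|j]; rewrite !mxE eqxx/= -val_eqE/=.
  have [jk|jk] := eqVneq (j : nat) k.
    by rewrite jk ltnn mulr1 addrAC subrr add0r (le_trans th).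
  rewrite mulr0 addr0; case: ifP => _; last by rewrite subrr normr0.
  by have := ler_coord_norm (y - x) j; rewrite !mxE.
have M0 : 0 <= M.
  by have [_ /(le_trans (normr_ge0 _))] := hf x ltac:(by rewrite subrr normr0) i.
rewrite -(subrKA (f (z k))) (le_trans (ler_normD _ _))// mulrSr mulrDl mul1r.
rewrite addrC lerD ?IH 1?ltnW//.
by rewrite (le_trans step)// ler_wpM2l.
Qed.

End RowVectors.

(** * Differences of smooth functions *)

Section SmoothFunctions.
Context {R : realType} {n : nat}.
Implicit Types (f g : 'rV[R]_n -> R) (W K : set 'rV[R]_n) (s : seq 'I_n).

(** The induction needs the equality near each point, since a derivative is
    determined by nearby values only; openness of [W] provides this. *)
Lemma iter_partialB W f g s :
    open W -> smooth_on W f -> smooth_on W g ->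
  forall x, W x -> iter_partial s (f \- g) x = iter_partial s f x - iter_partial s g x.
Proof.
move=> oW sf sg; elim: s => [//|i s IH] x Wx /=.
have near_eq : \forall y \near x,
    iter_partial s (f \- g) y = (iter_partial s f \- iter_partial s g) y.
  by apply: filterS (oW x Wx) => y /IH.
rewrite {1}/partial (near_eq_derive _ near_eq).
by rewrite deriveB //; [have [_] := sf s x Wx | have [_] := sg s x Wx].
Qed.

Lemma smooth_onB W f g :
  open W -> smooth_on W f -> smooth_on W g -> smooth_on W (f \- g).
Proof.
move=> oW sf sg s x Wx; have [cf df] := sf s x Wx; have [cg dg] := sg s x Wx.
have near_eq : \forall y \near x,
    (iter_partial s f \- iter_partial s g) y = iter_partial s (f \- g) y.
  by apply: filterS (oW x Wx) => y Wy; rewrite (iter_partialB s oW sf sg Wy).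
split=> [|i]; last first.
  apply: near_eq_derivable near_eq _.
  exact: derivableB.
rewrite /prop_for /continuous_at (iter_partialB s oW sf sg Wx).
apply: cvg_trans (near_eq_cvg near_eq) _.
exact: cvgB.
Qed.

Lemma mpartial0 f : mpartial (fun _ => 0%N) f = f.
Proof.
by rewrite /mpartial; elim: (enum 'I_n).
Qed.

Lemma mpartial_unit f (i : 'I_n) : mpartial (fun j => (j == i) : nat) f = partial i f.
Proof.
rewrite /mpartial (_ : flatten _ = [:: i])//.
rewrite -(filter_pred1_uniq (enum_uniq 'I_n) (mem_enum 'I_n i)).
by elim: (enum 'I_n) => //= j s ->; case: (j == i).
Qed.

Lemma le_sup_mpartial W K f alpha x :
    smooth_on W f -> compact K -> K `<=` W -> K x ->
  `|mpartial alpha f x| <= sup [set `|mpartial alpha f p| | p in K].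
Proof.
move=> sf cK KW Kx; apply: le_sup_norm => // q /KW Wq.
by have [] := sf (flatten [seq nseq (alpha i) i | i <- enum 'I_n]) q Wq.
Qed.

Lemma le_sup_smooth W K f x :
    smooth_on W f -> compact K -> K `<=` W -> K x ->
  `|f x| <= sup [set `|f p| | p in K].
Proof.
move=> sf cK KW Kx.
by have := le_sup_mpartial (fun _ => 0%N) sf cK KW Kx; rewrite mpartial0.
Qed.

End SmoothFunctions.

(** * Classes of nets *)

Section Nets.
Context {R : realType} {d : Order.disp_t} {I : preorderType d}.
Context (cI cJ : set (set I)) (eps : I -> R).
Hypotheses (base : tail_base cI) (neI : cI !=set0).
Context {V : normedZmodType R}.
Implicit Types (x y z : I -> V) (X : set V).

Lemma net_eqv_refl x : net_eqv cI eps x x.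
Proof. by move=> m; under eq_fun do rewrite subrr; exact: bigO0. Qed.

Lemma net_eqv_sym x y : net_eqv cI eps x y -> net_eqv cI eps y x.
Proof.
move=> xy m; apply: (bigO_le base (c := 1) _ _ (xy m)) => //.
by apply: for_smallT => // e; rewrite mul1r distrC.
Qed.

Lemma net_eqv_trans y x z :
  net_eqv cI eps x y -> net_eqv cI eps y z -> net_eqv cI eps x z.
Proof.
move=> xy yz m; have := bigOD base (xy m) (yz m).
by under eq_fun do rewrite subrKA.
Qed.

Lemma net_class_eq X x y :
  net_eqv cI eps x y -> net_class cI cJ eps X x = net_class cI cJ eps X y.
Proof.
move=> xy; apply/seteqP; split=> w [mw h]; split=> //.
  by apply: net_eqv_trans h; exact: net_eqv_sym.
exact: net_eqv_trans h.
Qed.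

Lemma net_eqv_small x y :
  for_small cI (fun e => x e = y e) -> net_eqv cI eps x y.
Proof.
move=> xy m; apply: (bigO_ext base (y := fun=> 0)); last exact: bigO0.
by apply: for_smallW xy => e ->; rewrite subrr.
Qed.

End Nets.

(** * Generalized functions and their values *)

Section GeneralizedFunctions.
Context {R : realType} {n : nat} {d : Order.disp_t} {I : preorderType d}.
Context (cI cJ : set (set I)) (eps : I -> R).
Context (Om : set 'rV[R]_n) (Ome : I -> set 'rV[R]_n).
Hypotheses (hOm : open Om) (hI : index_set cI) (hA2 : assumption2 cI cJ).
Hypotheses (hA3 : assumption3 cI eps) (hA4 : forall e, open (Ome e)).
Implicit Types (u v w : I -> 'rV[R]_n -> R) (x y : I -> 'rV[R]_n) (z : I -> R).
Implicit Types (K L : set 'rV[R]_n).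

Local Notation moderate := (moderate_family cJ eps Om Ome).
Local Notation null := (null_family cI cJ eps Om Ome).

Let base : tail_base cI := index_set_tail_base hI.
Let baseJ : tail_base cJ := sub_tail_base hI hA2.
Let JI : cJ `<=` cI. Proof. by have [] := hA2. Qed.
Let neJ : cJ !=set0. Proof. by have [] := hA2. Qed.
Let neI : cI !=set0. Proof. by have [A /JI] := neJ; exists A. Qed.
Let eps01 e : 0 < eps e <= 1. Proof. by have [] := hA3. Qed.

Lemma moderate_familyB u v :
  moderate u -> moderate v -> moderate (fun e => u e \- v e).
Proof.
move=> [su mu] [sv mv]; split=> [e|K KOm]; first exact: smooth_onB (@hA4 e) (su e) (sv e).
have [smallK mKu] := mu K KOm; have [_ mKv] := mv K KOm; split=> // alpha.
have [N hN] := mKu alpha; have [M hM] := mKv alpha; exists (maxn N M).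
apply: (bigO_le baseJ (c := 1)
    (y := fun e => sup_partial K alpha u e + sup_partial K alpha v e)) => //.
  apply: for_smallW smallK => e KOme.
  rewrite mul1r !ger0_norm ?addr_ge0 ?sup_norm_ge0//.
  apply: sup_norm_le => [|p Kp]; first by rewrite addr_ge0 ?sup_norm_ge0.
  rewrite /mpartial (iter_partialB _ (@hA4 e) (su e) (sv e) (KOme _ Kp)).
  rewrite (le_trans (ler_normB _ _))// lerD//.
  - exact: le_sup_mpartial (su e) KOm.1 KOme Kp.
  - exact: le_sup_mpartial (sv e) KOm.1 KOme Kp.
apply: bigOD => //.
- exact: bigO_expN_le (leq_maxl _ _) hN.
- exact: bigO_expN_le (leq_maxr _ _) hM.
Qed.

(** A value at a point of [K] is bounded by the supremum over [K] as soon as [K]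
    lies in the domain [Ome e], where [w e] is continuous. *)
Lemma null_value w x K :
    null w -> compact_in K Om -> for_small cI (fun e => K (x e)) ->
  forall m : nat, bigO cI (fun e => w e (x e)) (fun e => eps e ^+ m).
Proof.
move=> [[sw mw] nw] KOm Kx m; have [/(sub_for_small JI) smallK _] := mw K KOm.
apply: (bigO_le base (c := 1) _ _ (nw K KOm m)) => //.
apply: for_small2 smallK Kx => // e KOme Kxe.
rewrite mul1r (ger0_norm (sup_norm_ge0 _ _)).
exact: le_sup_smooth (sw e) KOm.1 KOme Kxe.
Qed.

Lemma null_familyB u v : null u -> null v -> null (fun e => u e \- v e).
Proof.
move=> [mu nu] [mv nv]; split=> [|K KOm m]; first exact: moderate_familyB.
have [/(sub_for_small JI) smallK _] := mu.2 K KOm.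
apply: (bigO_le base (c := 1) _ _ (bigOD base (nu K KOm m) (nv K KOm m))) => //.
apply: for_smallW smallK => e KOme.
rewrite mul1r !ger0_norm ?addr_ge0 ?sup_norm_ge0//.
apply: sup_norm_le => [|p Kp]; first by rewrite addr_ge0 ?sup_norm_ge0.
rewrite (le_trans (ler_normB _ _))// lerD//.
- exact: le_sup_smooth (mu.1 e) KOm.1 KOme Kp.
- exact: le_sup_smooth (mv.1 e) KOm.1 KOme Kp.
Qed.

(** The zero family need not be moderate by itself: membership demands that
    compact sets of [Om] eventually lie in the [Ome e], which any moderate
    family witnesses. *)
Lemma null_family0 u : moderate u -> null (fun _ _ => 0).
Proof.
move=> mu; split=> [|K KOm m].
  have := moderate_familyB mu mu; congr (moderate _).
  by apply/funext => e; apply/funext => p /=; rewrite subrr.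
apply: (bigO_ext base (y := fun=> 0)); last exact: bigO0.
apply: for_smallT => // e; apply/eqP; rewrite eq_le sup_norm_ge0 andbT.
by apply: sup_norm_le => // p _; rewrite normr0.
Qed.

Lemma family_eqv_refl u : moderate u -> family_eqv cI cJ eps Om Ome u u.
Proof.
move=> mu; have := null_family0 mu; congr (null _).
by apply/funext => e; apply/funext => p /=; rewrite subrr.
Qed.

Lemma family_eqv_common u v w :
    family_eqv cI cJ eps Om Ome u v -> family_eqv cI cJ eps Om Ome u w ->
  family_eqv cI cJ eps Om Ome v w.
Proof.
move=> uv uw; have := null_familyB uw uv; congr (null _).
by apply/funext => e; apply/funext => p /=; rewrite opprB addrC subrKA.
Qed.

Lemma gen_fun_class_eq u v :
    moderate u -> family_eqv cI cJ eps Om Ome u v ->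
  gen_fun_class cI cJ eps Om Ome u = gen_fun_class cI cJ eps Om Ome v.
Proof.
move=> mu uv; apply/seteqP; split=> w [mw h]; split=> //.
  exact: family_eqv_common uv h.
apply: family_eqv_common h.
exact: family_eqv_common uv (family_eqv_refl mu).
Qed.

(** Equivalent nets approach each other, so if one of them stays in a compact
    set then the whole balls spanned by the two stay in a slightly larger one. *)
Lemma net_eqv_thickening x y K :
    compact_in K Om -> for_small cI (fun e => K (x e)) -> net_eqv cI eps x y ->
  exists2 L, compact_in L Om &
    for_small cI (fun e => forall q, `|q - x e| <= `|y e - x e| -> L q).
Proof.
move=> KOm Kx xy; have [r [L r0 [LOm KL]]] := compact_thickening hOm KOm.
exists L => //.
apply: for_small2 Kx (bigO_eps_small base hA3 r0 (xy 1%N)) => // e Kxe.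
by rewrite distrC => xyr q qxy; apply: KL Kxe _; exact: le_trans qxy (ltW xyr).
Qed.

(** The moderate growth of the gradient is absorbed by the negligible distance
    of the two nets. *)
Lemma value_eqv u x y L :
    moderate u -> compact_in L Om -> net_eqv cI eps x y ->
    for_small cI (fun e => forall q, `|q - x e| <= `|y e - x e| -> L q) ->
  net_eqv cI eps (fun e => u e (x e)) (fun e => u e (y e)).
Proof.
move=> [su mu] LOm xy Lxy m.
have [/(sub_for_small JI) smallL mL] := mu L LOm.
pose G e := \sum_(i <- enum 'I_n) sup_partial L (fun j => (j == i) : nat) u e.
have [N /(sub_bigO JI) GN] : exists N : nat, bigO cJ G (fun e => eps e ^- N).
  by apply: bigO_expN_sum => // i; exact: mL.
have dxy : bigO cI (fun e => `|x e - y e|) (fun e => eps e ^+ (N + m)).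
  apply: (bigO_le base (c := 1) _ _ (xy (N + m)%N)) => //.
  by apply: for_smallT => // e; rewrite mul1r normr_id.
have := bigOM base GN dxy.
have -> : (fun e => eps e ^- N * eps e ^+ (N + m)) = (fun e => eps e ^+ m).
  apply/funext => e; have /andP[e0 _] := eps01 e.
  by rewrite exprD mulKf// expf_neq0// gt_eqF.
apply: (bigO_le base (c := n%:R)) => //.
apply: for_small2 smallL Lxy => // e LOme Lxye.
have G0 : 0 <= G e by apply: sumr_ge0 => i _; exact: sup_norm_ge0.
rewrite (ger0_norm (mulr_ge0 G0 (normr_ge0 _))) mulrA distrC [`|x e - y e|]distrC.
apply: mean_value_inequality => q /Lxye Lq i.
split; first by have [_] := su e [::] q (LOme q Lq).
rewrite -mpartial_unit.
apply: le_trans (le_sup_mpartial _ (su e) LOm.1 LOme Lq) _.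
rewrite /G (bigD1_seq i) ?mem_enum ?enum_uniq//= lerDl.
by apply: sumr_ge0 => j _; exact: sup_norm_ge0.
Qed.

(** Moderateness of a net is a condition along [cJ], whereas [x] lies in [K]
    only along [cI]; setting the value to 0 where [x] is outside [K] makes the
    bound by the supremum over [K] valid along [cJ]. *)
Lemma moderate_value u x K :
    moderate u -> compact_in K Om -> for_small cI (fun e => K (x e)) ->
  exists2 z, moderate_net cJ eps [set: R] z &
    for_small cI (fun e => Ome e (x e) /\ z e = u e (x e)).
Proof.
move=> [su mu] KOm Kx; have [smallK mK] := mu K KOm.
exists (fun e => if `[< K (x e) >] then u e (x e) else 0); last first.
  apply: for_small2 (sub_for_small JI smallK) Kx => // e KOme Kxe.
  by split; [exact: KOme|case: asboolP].
split=> //; have [N hN] := mK (fun _ => 0%N); exists N.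
apply: (bigO_le baseJ (c := 1) _ _ hN) => //.
apply: for_smallW smallK => e KOme.
rewrite mul1r (ger0_norm (sup_norm_ge0 _ _)).
case: asboolP => [Kxe|_]; last by rewrite normr0 sup_norm_ge0.
have := le_sup_mpartial (fun _ => 0%N) (su e) KOm.1 KOme Kxe.
by rewrite {1}mpartial0.
Qed.

(** Any two representatives of the value agree for small indices, hence are
    equivalent. *)
Lemma value_atE u x z :
    moderate_net cJ eps [set: R] z ->
    for_small cI (fun e => Ome e (x e) /\ z e = u e (x e)) ->
  value_at cI cJ eps Ome u x = net_class cI cJ eps [set: R] z.
Proof.
move=> mz zu; apply/seteqP; split=> [w [z' [_ z'u]]|w zw]; last by exists z.
rewrite (@net_class_eq _ _ _ cI cJ eps base neI _ _ z' z)//.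
apply: net_eqv_small => //.
by apply: for_small2 z'u zu => // e [_ ->] [_ ->].
Qed.

(** The change of representatives is split at [u e (y e)]: first the point moves,
    then the function. *)
Lemma value_at_eqv u v x y K :
    moderate u -> family_eqv cI cJ eps Om Ome u v ->
    moderate v -> compact_in K Om -> for_small cI (fun e => K (x e)) ->
    net_eqv cI eps x y ->
  value_at cI cJ eps Ome u x = value_at cI cJ eps Ome v y.
Proof.
move=> mu uv mv KOm Kx xy.
have [L LOm Lxy] := net_eqv_thickening KOm Kx xy.
have Ly : for_small cI (fun e => L (y e)) by apply: for_smallW Lxy => e; exact.
have [z mz zu] := moderate_value mu KOm Kx.
have [z' mz' z'v] := moderate_value mv LOm Ly.
rewrite (value_atE mz zu) (value_atE mz' z'v); apply: net_class_eq => //.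
apply: (@net_eqv_trans _ _ _ _ _ base _ (fun e => u e (x e))).
  by apply: net_eqv_small => //; apply: for_smallW zu => e [].
apply: (@net_eqv_trans _ _ _ _ _ base _ (fun e => u e (y e))).
  exact: value_eqv LOm xy Lxy.
apply: (@net_eqv_trans _ _ _ _ _ base _ (fun e => v e (y e))).
  exact: null_value uv LOm Ly.
by apply: net_eqv_small => //; apply: for_smallW z'v => e [].
Qed.

(** One net [z], computed from a single representative of the function and of
    the point, describes the value on all representatives. *)
Lemma gen_value_spec u xi :
    moderate u -> compact_points cI cJ eps Om xi ->
  exists x, exists2 z, moderate_net cJ eps [set: R] z &
    [/\ xi x, for_small cI (fun e => Ome e (x e)),
        gen_value cI cJ eps Ome (gen_fun_class cI cJ eps Om Ome u) xi =
          net_class cI cJ eps [set: R] z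
      & forall v y, gen_fun_class cI cJ eps Om Ome u v -> xi y ->
          value_at cI cJ eps Ome v y = net_class cI cJ eps [set: R] z].
Proof.
move=> mu [[x0 _ <-] [x [mx x0x] [K KOm Kx]]].
have [z mz zu] := moderate_value mu KOm Kx.
have val v y : gen_fun_class cI cJ eps Om Ome u v ->
    net_class cI cJ eps Om x0 y ->
    value_at cI cJ eps Ome v y = net_class cI cJ eps [set: R] z.
  move=> [mv uv] [my x0y]; rewrite -(value_atE mz zu); apply/esym.
  apply: value_at_eqv uv mv KOm Kx _ => //.
  by apply: net_eqv_trans x0y => //; exact: net_eqv_sym.
exists x, z => //; split=> //; first by apply: for_smallW zu => e [].
apply/seteqP; split=> [w [v uv [y xy]]|w zw]; first by rewrite (val v y).
have uu : gen_fun_class cI cJ eps Om Ome u u.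
  by split=> //; exact: family_eqv_refl.
by exists u => //; exists x => //; rewrite (val u x).
Qed.

Lemma compact_net_moderate x K :
  compact_in K Om -> (forall e, K (x e)) -> moderate_net cJ eps Om x.
Proof.
move=> KOm Kx; split=> [e|]; first exact: KOm.2.
have [M [_ hM]] := compact_bounded KOm.1; exists 0%N.
apply: (@bigO_bounded _ _ _ _ _ _ _ (M + 1)) => // e.
by apply: hM (Kx e); rewrite ltrDl.
Qed.

Lemma net_class_compact_points x K :
    compact_in K Om -> (forall e, K (x e)) ->
  compact_points cI cJ eps Om (net_class cI cJ eps Om x).
Proof.
move=> KOm Kx; have mx := compact_net_moderate KOm Kx.
split; first by exists x.
exists x; first by split=> //; exact: net_eqv_refl.
by exists K => //; apply: for_smallT.
Qed.

(** If all values at compactly supported points vanish, so do those at a net of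
    points of [K] where [u e] nearly attains its maximum over [K]. *)
Lemma null_of_values u :
    moderate u ->
    (forall xi, compact_points cI cJ eps Om xi ->
       gen_value cI cJ eps Ome (gen_fun_class cI cJ eps Om Ome u) xi =
         gen_real0 cI cJ eps) ->
  null u.
Proof.
move=> mu val0; split=> // K KOm m.
have [K0|K0] := pselect (K !=set0); last first.
  apply: (bigO_ext base (y := fun=> 0)); last exact: bigO0.
  apply: for_smallT => // e; have -> : K = set0.
    by apply/seteqP; split=> // p Kp; apply: K0; exists p.
  by rewrite image_set0 sup0.
have /choice[x hx] : forall e, exists p,
    K p /\ sup [set `|u e q| | q in K] <= 2 * `|u e p|.
  by move=> e; have [p Kp hp] := sup_norm_le2 (u e) K0; exists p.
have Kx e : K (x e) by have [] := hx e.
have cx := net_class_compact_points KOm Kx.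
have [_ [z mz [_ _ gz vz]]] := gen_value_spec mu cx.
have : value_at cI cJ eps Ome u x (fun=> 0).
  rewrite vz.
  - rewrite -gz val0//; split; last exact: net_eqv_refl.
    by split=> //; exists 0%N; exact: bigO0.
  - by split=> //; exact: family_eqv_refl.
  - by split; [exact: compact_net_moderate KOm Kx|exact: net_eqv_refl].
move=> [z' [_ z'u [_ z'0]]].
apply: (bigO_le base (c := 2) _ _ (z'0 m)) => //.
apply: for_smallW z'u => e [_ ->]; rewrite subr0 ger0_norm ?sup_norm_ge0//.
by have [] := hx e.
Qed.

End GeneralizedFunctions.

Theorem theorem37 (R : realType) (n : nat) (d : Order.disp_t)
    (I : preorderType d) (cI cJ : set (set I)) (eps : I -> R)
    (Om : set 'rV[R]_n) (Ome : I -> set 'rV[R]_n)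
    (U : set (I -> 'rV[R]_n -> R))
    (hOm : open Om) (hI : index_set cI)
    (hA1 : assumption1 cI) (hA2 : assumption2 cI cJ)
    (hA3 : assumption3 cI eps) (hA4 : forall e, open (Ome e))
    (hU : gen_functions cI cJ eps Om Ome U) :
  (forall xi, compact_points cI cJ eps Om xi ->
     gen_value_well_defined cI cJ eps Ome U xi) /\
  (U = gen_fun0 cI cJ eps Om Ome <->
   forall xi, compact_points cI cJ eps Om xi ->
     gen_value cI cJ eps Ome U xi = gen_real0 cI cJ eps).
Proof.
case: hU => u mu; rewrite -/(gen_fun_class cI cJ eps Om Ome u) => <-.
have null0 := null_family0 hI hA2 hA3 hA4 mu.
split=> [xi cxi|].
  have [_ [z mz [_ _ gz vz]]] := gen_value_spec hOm hI hA2 hA3 hA4 mu cxi.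
  split=> [|v y uv xiy]; first by rewrite gz; exists z.
  by rewrite gz; exact: vz.
split=> [u0 xi cxi|val0].
  have [x [z mz [xix smallx -> vz]]] := gen_value_spec hOm hI hA2 hA3 hA4 mu cxi.
  have U0 : gen_fun_class cI cJ eps Om Ome u (fun _ _ => 0).
    rewrite u0; split; first exact: null0.1.
    exact: (family_eqv_refl hI hA2 hA3 hA4 null0.1).
  rewrite -(vz _ _ U0 xix); apply: (value_atE hI hA2).
    by split=> //; exists 0%N; apply: bigO0; case: hA2.
  by apply: for_smallW smallx.
apply: gen_fun_class_eq => //.
have := null_of_values hOm hI hA2 hA3 hA4 mu val0; congr (null_family _ _ _ _ _ _).
by apply/funext => e; apply/funext => p /=; rewrite subr0.
Qed.
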